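(* Let $\theta<\kappa<\lambda$ be regular cardinals with $\kappa^{++}<\lambda$, and let $\mathcal{D}$ be a uniform $\theta$-covering matrix for $\lambda$. Then $A_{\mathcal{D}}\cap S^\lambda_\kappa$ is stationary in $\lambda$.
   Context: $S^\lambda_\kappa=\{\alpha<\lambda\mid\mathrm{cf}(\alpha)=\kappa\}$. For regular $\theta<\lambda$, a $\theta$-covering matrix for $\lambda$ is $\mathcal{D}=\langle D(i,\beta)\mid i<\theta,\beta<\lambda\rangle$ with $\beta=\bigcup_{i<\theta}D(i,\beta)$, $D(i,\beta)\subseteq D(j,\beta)$ for $i<j$, and for $\beta<\gamma<\lambda$, $i<\theta$ some $j<\theta$ with $D(i,\beta)\subseteq D(j,\gamma)$. It is uniform if for every limit $\beta<\lambda$ there is $i<\theta$ with $D(i,\beta)$ containing a club in $\beta$. When $\theta^+<\lambda$, $\beta<\lambda$ with $\mathrm{cf}(\beta)>\theta$ is a good point for $\mathcal{D}$ if there is an unbounded $A\subseteq\beta$ such that for every $\gamma<\beta$ there are $\alpha<\beta$ and $i<\theta$ with $A\cap\gamma\subseteq D(i,\alpha)$; $A_{\mathcal{D}}$ is the set of good points. *)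

(* Defs.v *)
From HB Require Import structures.
From mathcomp Require Import all_boot all_order.
From mathcomp Require Import boolp classical_sets functions cardinality.
From mathcomp Require Import wochoice.

Set Implicit Arguments.
Unset Strict Implicit.
Unset Printing Implicit Defensive.

Import Order.TTheory.

Local Open Scope classical_set_scope.
Local Open Scope order_scope.

(** Ordinals are the elements of a well-ordered type [O], i.e. of an arbitrary
    initial segment of the ordinals; an ordinal [a] is identified with the set
    [seg a] of its predecessors. Each notion below depends only on ordinals up
    to those it mentions, so the choice of [O] does not matter, and every
    ordinal [l] is covered (take [O] to be [l + 1]). *)

Definition seg (d : Order.disp_t) (O : orderType d) (a : O) : set O :=
  [set x | x < a].

Definition limit_ordinal (d : Order.disp_t) (O : orderType d) (a : O) : Prop :=
  (exists x, x < a) /\ (forall x, x < a -> exists2 y, x < y & y < a).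

(** The weak inequality makes [{c}] unbounded in [c + 1]; at limit ordinals it
    is equivalent to the strict one. *)
Definition unbounded_in (d : Order.disp_t) (O : orderType d)
    (b : O) (A : set O) : Prop :=
  A `<=` seg b /\ (forall x, x < b -> exists2 y, A y & x <= y).

Definition cofinal_map (d : Order.disp_t) (O : orderType d)
    (a e : O) (f : O -> O) : Prop :=
  unbounded_in a (f @` seg e).

(** The least [e] that admits a cofinal map [e -> a]. The default value of
    [xget] is never used, because the identity is a cofinal map [a -> a]. *)
Definition cf (d : Order.disp_t) (O : orderType d) (a : O) : O :=
  let P := [set e | exists f, cofinal_map a e f] in
  xget a [set e | P e /\ forall e', P e' -> e <= e'].

Definition is_cardinal (d : Order.disp_t) (O : orderType d) (k : O) : Prop :=
  forall a, a < k -> ~ (seg k #<= seg a)%card.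

Definition regular_cardinal (d : Order.disp_t) (O : orderType d) (k : O) :
    Prop :=
  [/\ is_cardinal k, infinite_set (seg k) & cf k = k].

(** [m] is the cardinal successor of [k]. A relation, because [O] need not
    contain such an [m]. *)
Definition is_succ_cardinal (d : Order.disp_t) (O : orderType d) (k m : O) :
    Prop :=
  [/\ is_cardinal m, k < m & forall n, is_cardinal n -> k < n -> m <= n].

Definition club_in (d : Order.disp_t) (O : orderType d)
    (b : O) (C : set O) : Prop :=
  unbounded_in b C /\
  (forall a, a < b -> limit_ordinal a -> unbounded_in a (C `&` seg a) -> C a).

Definition stationary_in (d : Order.disp_t) (O : orderType d)
    (l : O) (S : set O) : Prop :=
  S `<=` seg l /\ (forall C, club_in l C -> S `&` C !=set0).

(** [S^l_k] *)
Definition cof_set (d : Order.disp_t) (O : orderType d) (l k : O) : set O :=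
  [set a | a < l /\ cf a = k].

(** Only the values [D i b] with [i < t] and [b < l] are meaningful. *)
Definition covering_matrix (d : Order.disp_t) (O : orderType d)
    (t l : O) (D : O -> O -> set O) : Prop :=
  [/\ forall b, b < l -> seg b = \bigcup_(i in seg t) D i b,
      forall b i j, b < l -> i < j -> j < t -> D i b `<=` D j b
    & forall b c i, b < c -> c < l -> i < t ->
        exists2 j, j < t & D i b `<=` D j c].

Definition uniform_matrix (d : Order.disp_t) (O : orderType d)
    (t l : O) (D : O -> O -> set O) : Prop :=
  forall b, b < l -> limit_ordinal b ->
    exists2 i, i < t & exists2 C, club_in b C & C `<=` D i b.

Definition good_points (d : Order.disp_t) (O : orderType d)
    (t l : O) (D : O -> O -> set O) : set O :=
  [set b | [/\ b < l, t < cf b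
    & exists2 A, unbounded_in b A &
        forall c, c < b -> exists a i,
          [/\ a < b, i < t & A `&` seg c `<=` D i a]]].

Lemma cfP (d : Order.disp_t) (O : orderType d) (a : O) :
  well_order (<=%O : rel O) ->
  (exists f, cofinal_map a (cf a) f) /\
  (forall e f, cofinal_map a e f -> cf a <= e).
Proof.
move=> wo; pose P := [set e | exists f, cofinal_map a e f].
pose Q := [set e | P e /\ forall e', P e' -> e <= e'].
suff: Q (cf a).
  by move=> [Pc lec]; split=> [|e f ef]; [exact: Pc | apply: lec; exists f].
apply: xgetPex.
have Pa : P a.
  exists id; split=> [_ [x xa <-] //|x xa].
  by exists x => //; exists x.
have [|m [[mP minm] _]] := wo [pred e | `[< P e >]].
  by exists a; apply/asboolP.
exists m; split; first exact/asboolP.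
by move=> e Pe; apply: minm; apply/asboolP.
Qed.

(* Main.v *)
(** Since [theta < kappa], [kappa] is uncountable, so Shelah's club guessing
    gives sets [C a], for [a < kappa^++] of cofinality [kappa], such that every
    club of [kappa^++] includes some [C a] that is unbounded in [a]. Given a
    club [E] of [lambda], choose an increasing continuous sequence [g x],
    [x < kappa^++], in [E] such that whenever the image under [g] of a proper
    initial segment of some [C a] lies in some [D i c], it lies in one with [c]
    below the next value of [g]; this is possible because there are fewer than
    [lambda] such images. Let [delta] be the supremum of [g]. By uniformity some
    [D i delta] contains a club of [delta], hence contains [g x] for club many
    [x]. If [C a] guesses this club, the image of [C a] under [g] witnesses that
    [g a], an element of [E] of cofinality [kappa], is good: its initial
    segments are covered by [D i delta], hence already by matrix entries below
    [g a]. *)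

Require Import Defs.
From mathcomp Require Import all_boot all_order.
From mathcomp Require Import boolp classical_sets functions cardinality.
From mathcomp Require Import wochoice.

Set Implicit Arguments.
Unset Strict Implicit.
Unset Printing Implicit Defensive.

Import Order.TTheory.

Local Open Scope order_scope.
Local Open Scope classical_set_scope.

(** * Comparing cardinalities; recursion on well-founded relations *)

Lemma card_le_inj T U (A : set T) (B : set U) (u0 : U) : (A #<= B)%card ->
  exists f : T -> U, (forall x, A x -> B (f x)) /\
    (forall x y, A x -> A y -> f x = f y -> x = y).
Proof.
elim/Ppointed: U => U in B u0 *; first by case: (no u0).
move=> /pcard_leP[f]; exists f; split=> [x Ax|x y Ax Ay]; first exact: funS.
by apply: (@inj _ _ _ f); exact/mem_set.
Qed.

Lemma inj_card_leW T U (A : set T) (B : set U) (f : T -> U) :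
  (forall x, A x -> B (f x)) ->
  (forall x y, A x -> A y -> f x = f y -> x = y) -> (A #<= B)%card.
Proof.
move=> fB finj; apply: (@card_le_trans _ _ _ (f @` A)).
  have /inj_card_eq : {in A &, injective f}.
    by move=> x y /set_mem Ax /set_mem Ay; exact: finj.
  by rewrite card_eq_le => /andP[].
by apply: subset_card_le => _ [x Ax <-]; exact: fB.
Qed.

Lemma card_le_surj T U (A : set T) (B : set U) : A !=set0 -> (A #<= B)%card ->
  exists g : U -> T, g @` B = A.
Proof.
move=> [a0 Aa0]; have [[u0]|noU] := pselect (inhabited U); last first.
  elim/Ppointed: U => U in B noU *; last by case: noU; exists; exact: point.
  by rewrite card_le_emptyr => /eqP A0; move: Aa0; rewrite A0.
move=> /(card_le_inj u0)[f [fB finj]].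
have /boolp.choice[g gP] : forall u, exists v,
    A v /\ (forall x, A x -> f x = u -> v = x).
  move=> u; have [[x Ax fx]|nx] := pselect (exists2 x, A x & f x = u).
    by exists x; split=> // y Ay fy; apply: finj => //; rewrite fx.
  by exists a0; split=> // x Ax fx; case: nx; exists x.
exists g; apply/seteqP; split=> [_ [u _ <-]|x Ax]; first by have [] := gP u.
by exists (f x); [exact: fB|have [_] := gP (f x); exact].
Qed.

Lemma card_le_setX S T U V (A : set S) (B : set T) (A' : set U) (B' : set V)
    (u0 : U) (v0 : V) :
  (A #<= A' -> B #<= B' -> A `*` B #<= A' `*` B')%card.
Proof.
move=> /(card_le_inj u0)[f [fA finj]] /(card_le_inj v0)[g [gB ginj]].
apply: (@inj_card_leW _ _ _ _ (fun p => (f p.1, g p.2))).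
  by move=> [x y] [/= /fA ? /gB ?].
by move=> [x y] [x' y'] [/= ? ?] [/= ? ?] [/finj -> // /ginj ->].
Qed.

(** Hilbert's hotel: along an injected copy of [nat] in [A], a new point [x] moves to [u 0] and each
    [u n] to [u n.+1]. *)
Lemma infinite_card_setU1 T (A : set T) x :
  infinite_set A -> ((x |` A) #<= A)%card.
Proof.
move=> /infiniteP/(card_le_inj x)[u [uA uinj]].
have {}uinj i j : u i = u j -> i = j by apply: uinj.
have [Ax|nAx] := pselect (A x).
  by apply: subset_card_le => y [->|].
have /boolp.choice[h hP] : forall y, exists z,
    [\/ y = x /\ z = u 0%N, exists2 n, y = u n & z = u n.+1 |
        [/\ y <> x, forall n, y <> u n & z = y]].
  move=> y; have [->|yx] := pselect (y = x).
    by exists (u 0%N); constructor 1.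
  have [[n yu]|nu] := pselect (exists n, y = u n).
    by exists (u n.+1); constructor 2; exists n.
  by exists y; constructor 3; split=> // n yu; apply: nu; exists n.
apply: (@inj_card_leW _ _ _ _ h) => [y [yx|Ay]|y z _ _].
- case: (hP y) => [[_ ->]|[n _ ->]|[]]; rewrite ?yx //; exact: uA.
- by case: (hP y) => [[_ ->]|[n _ ->]|[_ _ ->]] //; exact: uA.
- case: (hP y) => [[-> ->]|[n -> ->]|[yx yu ->]];
    case: (hP z) => [[-> ->]|[m -> ->]|[zx zu ->]] //.
  + by move=> /uinj.
  + by move=> /esym /zu.
  + by move=> /uinj.
  + by move=> /uinj [->].
  + by move=> /esym /zu.
  + by move=> /yu.
  + by move=> /yu.
Qed.

(** The step [F] takes a total function, which spares later recursions dependent types. The value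
    [t0] fills in for arguments that are not predecessors, and [F] cannot see it. *)
Lemma wf_recursion (X T : Type) (R : X -> X -> Prop) (t0 : T)
    (F : X -> (X -> T) -> T) : well_founded R ->
  (forall x g h, (forall y, R y x -> g y = h y) -> F x g = F x h) ->
  exists f, forall x, f x = F x f.
Proof.
move=> wfR Fext.
pose step x (rec : forall y, R y x -> T) :=
  F x (fun y => if pselect (R y x) is left h then rec y h else t0).
exists (Fix wfR (fun=> T) step) => x; rewrite Fix_eq /step.
  by apply: Fext => y Ryx; case: pselect.
move=> z g h gh; apply: Fext => y _; case: pselect => // r; exact: gh.
Qed.

(** * Well-orders, infinite squares and successor cardinals *)

Section WellOrder.
Context {d : Order.disp_t} {O : orderType d}.
Hypothesis O_wo : well_order (<=%O : rel O).
Implicit Types (a b k m x y z : O) (A B : set O).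

Lemma ex_least A : A !=set0 -> exists2 m, A m & forall x, A x -> m <= x.
Proof.
move=> [a Aa]; have [|m [[mA minm] _]] := O_wo (A := [pred x | `[< A x >]]).
  by exists a; apply/asboolP.
exists m; first exact/asboolP.
by move=> x Ax; apply: minm; apply/asboolP.
Qed.

Lemma wo_lt_wf : well_founded (fun x y : O => x < y).
Proof.
move=> a; apply: contrapT => nAcc.
have [m nm minm] := ex_least (A := [set x | ~ Acc (fun x y : O => x < y) x])
  (ex_intro _ a nAcc).
apply: nm; constructor=> y ym; apply: contrapT => ny.
by have := minm y ny; rewrite leNgt ym.
Qed.

Lemma wo_ind (P : O -> Prop) :
  (forall x, (forall y, y < x -> P y) -> P x) -> forall x, P x.
Proof. exact: well_founded_ind wo_lt_wf P. Qed.

Lemma seg_sub a b : a <= b -> seg a `<=` seg b.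
Proof. by move=> ab x xa; exact: lt_le_trans xa ab. Qed.

Lemma card_seg_le a b : a <= b -> (seg a #<= seg b)%card.
Proof. by move=> /seg_sub/subset_card_le. Qed.

Lemma infinite_seg_le a b :
  a <= b -> infinite_set (seg a) -> infinite_set (seg b).
Proof. by move=> /seg_sub/sub_infinite_set. Qed.

(** If [x] were the largest element below [a], then [seg a] would be [seg x] plus one point, which
    is no larger than the infinite set [seg x]. *)
Lemma infinite_cardinal_limit a :
  is_cardinal a -> infinite_set (seg a) -> limit_ordinal a.
Proof.
move=> acard ainf; split; first exact: (infinite_setN0 ainf).
move=> x xa; apply: contrapT => nxa; apply: (acard x xa).
have sax : seg a `<=` x |` seg x.
  move=> y ya; have [yx|xy|->] := ltgtP y x; [by right| |by left].
  by case: nxa; exists y.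
apply: card_le_trans (subset_card_le sax) _; apply: infinite_card_setU1 => xfin.
by apply: ainf; apply: sub_finite_set sax _; rewrite finite_setU.
Qed.

(* Below [p] there are only pairs from [seg m `*` seg m], for any [m] above both
   components of [p]. *)
Definition goedel_lt (p q : O * O) : Prop :=
  let m (r : O * O) := Order.max r.1 r.2 in
  m p < m q \/ m p = m q /\ (p.1 < q.1 \/ p.1 = q.1 /\ p.2 < q.2).

Lemma goedel_lt_wf : well_founded goedel_lt.
Proof.
suff H m x y : Order.max x y = m -> Acc goedel_lt (x, y).
  by move=> p; case: p => x y; exact: H erefl.
elim/wo_ind: m x y => m IHm x; elim/wo_ind: x => x IHx y.
elim/wo_ind: y => y IHy mE; constructor=> -[x' y'].
rewrite /goedel_lt /= mE => -[lt|[eq [lt|[xx lt]]]].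
- exact: IHm lt _ _ erefl.
- exact: IHx.
- by rewrite xx in eq *; exact: IHy.
Qed.

Lemma goedel_lt_total p q : [\/ p = q, goedel_lt p q | goedel_lt q p].
Proof.
case: p q => x y [x' y']; rewrite /goedel_lt /=.
have [||eq] := ltgtP (Order.max x y) (Order.max x' y').
- by constructor 2; left.
- by constructor 3; left.
have [lt|lt|xx] := ltgtP x x'.
- by constructor 2; right; split=> //; left.
- by constructor 3; right; split=> //; left.
have [lt|lt|yy] := ltgtP y y'.
- by constructor 2; right; split=> //; right.
- by constructor 3; right; split=> //; right.
by constructor 1; rewrite xx yy.
Qed.

(** Goedel's argument, by induction on [a]. For a cardinal [a], recursion along [goedel_lt] sends
    each pair to the least element of [seg a] not yet used; too few pairs come earlier to exhaust
    [seg a]. *)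
Lemma card_seg_square a :
  infinite_set (seg a) -> (seg a `*` seg a #<= seg a)%card.
Proof.
elim/wo_ind: a => a IH ainf.
have [acard|] := pselect (is_cardinal a); last first.
  move=> /existsNP[b /not_implyP[ba /contrapT ab]].
  have binf : infinite_set (seg b).
    by move=> bfin; apply: ainf; exact: card_le_finite ab bfin.
  apply: card_le_trans (card_le_setX a a ab ab) _.
  apply: card_le_trans (IH b ba binf) _.
  exact: card_seg_le (ltW ba).
have [_ alim] := infinite_cardinal_limit acard ainf.
pose pred p := [set q | goedel_lt q p] `&` (seg a `*` seg a).
pose least (g : O * O -> O) p := [set z | (seg a `\` g @` pred p) z /\
  forall z', (seg a `\` g @` pred p) z' -> z <= z'].
have [f fE] : exists f, forall p, f p = xget a (least f p).
  apply: (wf_recursion a goedel_lt_wf) => p g h gh; congr xget; rewrite /least.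
  suff -> : g @` pred p = h @` pred p by [].
  by apply: eq_imagel => q [/gh].
have fP p : (seg a `*` seg a) p -> (seg a `\` f @` pred p) (f p).
  case: p => x y [/= xa ya]; rewrite [f _]fE.
  suff : seg a `\` f @` pred (x, y) !=set0.
    move=> /ex_least[m mA minm].
    by case: (xgetPex a (ex_intro (least f (x, y)) m (conj mA minm))).
  apply/set0P/negP => /eqP; rewrite setD_eq0 => sub.
  (* Since [a] is a limit, some [m] below it exceeds both components, so all earlier pairs lie in
     the square of [seg m]. *)
  have [m xm ma] : exists2 m, Order.max x y < m & m < a.
    by apply: alim; rewrite gt_max xa ya.
  have predm : pred (x, y) `<=` seg m `*` seg m.
    move=> [x' y'] [/= lt _].
    have : Order.max x' y' <= Order.max x y by case: lt => [/ltW|[/= ->]].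
    by rewrite ge_max => /andP[x'm y'm]; split=> /=; exact: le_lt_trans xm.
  have am : (seg a #<= seg m `*` seg m)%card.
    apply: card_le_trans (subset_card_le sub) _.
    by apply: card_le_trans (card_image_le _ _) (subset_card_le predm).
  have [mfin|minf] := pselect (finite_set (seg m)).
    by apply: ainf; apply: card_le_finite am _; exact: finite_setX.
  by apply: (acard m ma); apply: card_le_trans am (IH m ma minf).
apply: (@inj_card_leW _ _ _ _ f) => [p /fP[]//|p q pa qa fpq].
have [//|pq|qp] := goedel_lt_total p q.
  by have [_ []] := fP q qa; exists p.
by have [_ []] := fP p pa; exists q.
Qed.

(** Coding a point by a chosen index and by its code in that member injects the union into the
    square of [seg k]. *)
Lemma card_bigcup_le I T (J : set I) (B : I -> set T) k :
  infinite_set (seg k) -> (J #<= seg k)%card ->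
  (forall j, J j -> (B j #<= seg k)%card) ->
  (\bigcup_(j in J) B j #<= seg k)%card.
Proof.
move=> kinf /(card_le_inj k)[u [uk uinj]] Bk.
have /boolp.choice[e eP] : forall j, exists e : T -> O, J j ->
    (forall x : T, B j x -> e x < k) /\
    (forall x y : T, B j x -> B j y -> e x = e y -> x = y).
  move=> j; have [Jj|nJ] := pselect (J j); last by exists (fun=> k).
  by have /(card_le_inj k)[e ?] := Bk j Jj; exists e.
apply: card_le_trans (card_seg_square kinf).
have /boolp.choice[i iP] : forall x : T, exists p : O * O,
    (\bigcup_(j in J) B j) x -> exists j, [/\ J j, B j x & p = (u j, e j x)].
  move=> x; have [[j Jj Bx]|nB] := pselect ((\bigcup_(j in J) B j) x).
    by exists (u j, e j x) => _; exists j.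
  by exists (k, k).
apply: (@inj_card_leW _ _ _ _ i) => [x /iP[j [Jj Bx ->]]|x y].
  by split=> /=; [exact: uk|exact: (eP j Jj).1].
move=> /iP[j [Jj Bx ->]] /iP[j' [Jj' By ->]] [/uinj jj'].
have {}jj' := jj' Jj Jj'; rewrite -jj' in By *.
exact: (eP j Jj).2.
Qed.

(** The least [n] into whose segment [seg b] injects is a cardinal and at most [b], hence below [m],
    so it cannot exceed [k]. *)
Lemma lt_succ_cardinal k m b : is_succ_cardinal k m -> b < m ->
  (seg b #<= seg k)%card.
Proof.
move=> [_ _ minm] bm.
have [n bn minn] := ex_least (A := [set n | (seg b #<= seg n)%card])
  (ex_intro _ b (card_lexx _)).
have ncard : is_cardinal n.
  by move=> a an na; have := minn a (card_le_trans bn na); rewrite leNgt an.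
have [kn|nk] := ltP k n; last exact: card_le_trans bn (card_seg_le nk).
have := le_lt_trans (le_trans (minm n ncard kn) (minn b (card_lexx _))) bm.
by rewrite ltxx.
Qed.

(** Otherwise [seg m] would be a union of at most [k] sets of size at most [k], and would inject
    into [seg k]. *)
Lemma succ_cardinal_cf k m :
  infinite_set (seg k) -> is_succ_cardinal k m -> k < cf m.
Proof.
move=> kinf mk; have [mcard km _] := mk; rewrite ltNge; apply/negP => cfk.
have minf := infinite_seg_le (ltW km) kinf.
have [_ mlim] := infinite_cardinal_limit mcard minf.
have [[f [fm funb]] _] := cfP m O_wo.
apply: (mcard k km).
(* Cofinality uses the weak inequality, so [f j] itself has to be added to its segment. *)
apply: (@card_le_trans _ _ _ (\bigcup_(j in seg (cf m)) (f j |` seg (f j)))).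
  apply: subset_card_le => x xm; have [_ [j jcf <-] xf] := funb x xm.
  by exists j => //; move: xf; rewrite le_eqVlt => /orP[/eqP|]; [left|right].
apply: card_bigcup_le => // [|j jcf]; first exact: card_seg_le.
have [y fy ym] : exists2 y, f j < y & y < m by apply: mlim; apply: fm; exists j.
apply: card_le_trans (lt_succ_cardinal mk ym); apply: subset_card_le.
by move=> x [->//|xf]; exact: lt_trans xf fy.
Qed.

End WellOrder.

(** * Cofinality, suprema and clubs *)

Section Cofinality.
Context {d : Order.disp_t} {O : orderType d}.
Hypothesis O_wo : well_order (<=%O : rel O).
Implicit Types (a b e s x y z : O) (A B : set O).

(** A subset of [seg a] without a strict upper bound below [a] is unbounded in [a]; enumerating it
    by [seg e] would give a cofinal map of length less than [cf a]. *)
Lemma bounded_lt_cf a e B : B `<=` seg a -> (B #<= seg e)%card -> e < cf a ->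
  exists2 y, y < a & forall b, B b -> b < y.
Proof.
move=> Ba Be ecf; apply: contrapT => nbd.
have Bunb : unbounded_in a B.
  split=> // x xa; apply: contrapT => nx; apply: nbd; exists x => // b Bb.
  by rewrite ltNge; apply/negP => xb; apply: nx; exists b.
have [_ cfmin] := cfP a O_wo.
(* The enumeration needs a point of [B]. The empty set is unbounded only in the least ordinal, where
   [cf a <= a] leaves no room for [e]. *)
have [B0|/eqP/set0P[b Bb]] := pselect (B = set0).
  have noa x : ~ x < a by move=> xa; have [b] := Bunb.2 x xa; rewrite B0.
  have : cf a <= a.
    by apply: (cfmin _ id); split=> [_ [x /noa//]|x /noa//].
  by move=> /(lt_le_trans ecf)/noa.
have [g gB] := card_le_surj (ex_intro _ b Bb) Be.
have /cfmin : cofinal_map a e g by rewrite /cofinal_map gB.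
by rewrite leNgt ecf.
Qed.

(** Here [s] is the least strict upper bound. If [B] has a largest element, [s] is its successor,
    and the weak inequality in [unbounded_in] makes the conclusion hold there too. *)
Lemma ex_sup_lt_cf a e B : B `<=` seg a -> (B #<= seg e)%card -> e < cf a ->
  exists2 s, s < a & unbounded_in s B.
Proof.
move=> Ba Be ecf; have [y ya By] := bounded_lt_cf Ba Be ecf.
have [s Bs mins] := ex_least O_wo (A := [set s | forall b, B b -> b < s])
  (ex_intro _ y By).
exists s; first exact: le_lt_trans (mins y By) ya.
split=> [b /Bs//|x xs]; apply: contrapT => nx.
suff /mins : forall b, B b -> b < x by rewrite leNgt xs.
by move=> b Bb; rewrite ltNge; apply/negP => xb; apply: nx; exists b.
Qed.

(** The element [e0] makes [seg e] nonempty, so singletons are bounded below [a]; this rules out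
    successors, whose cofinality is 1. *)
Lemma lt_cf_limit e0 e a : e0 < e -> e < cf a -> limit_ordinal a.
Proof.
move=> e0e ecf; split.
  have [y ya _] := bounded_lt_cf (@sub0set _ (seg a)) (card_ge0 _ (seg e)) ecf.
  by exists y.
move=> x xa; have [||y ya xy] := @bounded_lt_cf a e [set x] _ _ ecf.
- by move=> _ ->.
- by apply: (@inj_card_leW _ _ _ _ (fun=> e0)) => // ? ? -> ->.
- by exists y => //; exact: xy.
Qed.

Lemma unbounded_limit s B : unbounded_in s B -> B !=set0 ->
  (forall b, B b -> exists2 b', B b' & b < b') -> limit_ordinal s.
Proof.
move=> [Bs Bunb] [b Bb] Bnext; split; first by exists b; exact: Bs.
move=> x /Bunb[y By xy]; have [z Bz yz] := Bnext y By.
by exists z; [exact: le_lt_trans yz|exact: Bs].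
Qed.

Lemma limit_unbounded_lt a B x : limit_ordinal a -> unbounded_in a B -> x < a ->
  exists2 y, B y & x < y.
Proof.
move=> [_ alim] [_ Bunb] xa; have [z xz /Bunb[y By zy]] := alim x xa.
by exists y => //; exact: lt_le_trans zy.
Qed.

(** A cofinal map into [a] is composed with [g]. A cofinal map into [b] is composed with a choice,
    for each [x < b], of an index in [a] at which [g] is at least [x]. *)
Lemma cf_increasing_map a b (g : O -> O) :
  (forall x y, x < y -> y < a -> g x < g y) -> unbounded_in b (g @` seg a) ->
  cf b = cf a.
Proof.
move=> gincr [gb gunb].
have gle x y : x <= y -> y < a -> g x <= g y.
  by rewrite le_eqVlt => /orP[/eqP->//|xy ya]; exact/ltW/gincr.
have [[f [fa funb]] cfamin] := cfP a O_wo.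
have [[h [hb hunb]] cfbmin] := cfP b O_wo.
apply/eqP; rewrite eq_le; apply/andP; split.
  apply: (cfbmin _ (g \o f)); split=> [_ [x xcf <-]|x xb].
    by apply: gb; exists (f x) => //; apply: fa; exists x.
  have [_ [y ya <-] xy] := gunb x xb.
  have [_ [z zcf <-] yz] := funb y ya.
  exists (g (f z)); first by exists z.
  by apply: le_trans xy (gle _ _ yz _); apply: fa; exists z.
have /boolp.choice[k kP] : forall x, exists y, x < b -> y < a /\ x <= g y.
  move=> x; have [xb|nxb] := pselect (x < b); last by exists x.
  by have [_ [y ya <-] xy] := gunb x xb; exists y.
have hP x : x < cf b -> h x < b by move=> xcf; apply: hb; exists x.
apply: (cfamin _ (k \o h)); split=> [_ [x xcf <-]|x xa].
  by have [] := kP _ (hP x xcf).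
have [|_ [y ycf <-] xy] := hunb (g x); first by apply: gb; exists x.
exists (k (h y)); first by exists y.
have [ka hk] := kP _ (hP y ycf).
rewrite leNgt; apply/negP => /gincr -/(_ xa); rewrite ltNge.
by rewrite (le_trans xy hk).
Qed.

(* [y] is the supremum of an [omega]-sequence of [Q]-steps starting at [x]. *)
Lemma omega_closure t a (Q : O -> O -> Prop) :
  infinite_set (seg t) -> t < cf a ->
  (forall x, x < a -> exists y, [/\ x < y, y < a & Q x y]) ->
  forall x, x < a -> exists y, [/\ x < y, y < a, limit_ordinal y &
    forall z, z < y -> exists z1 z2, [/\ z <= z1, Q z1 z2 & z2 < y]].
Proof.
move=> tinf tcf Qnext x xa.
have /boolp.choice[f fP] : forall x, exists y, x < a -> [/\ x < y, y < a & Q x y].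
  move=> z; have [za|nza] := pselect (z < a); last by exists z.
  by have [y ?] := Qnext z za; exists y.
pose u n := iter n f x.
have ua n : u n < a by elim: n => //= n /fP[].
have uS n : u n < u n.+1 by have [] := fP (u n) (ua n).
have [||y ya uy] := @ex_sup_lt_cf a t (range u) _ _ tcf.
- by move=> _ [n _ <-]; exact: ua.
- apply: card_le_trans (card_image_le _ _) _; exact/infiniteP.
have ylim : limit_ordinal y.
  apply: unbounded_limit uy _ _; first by exists (u 0%N); exists 0%N.
  by move=> _ [n _ <-]; exists (u n.+1) => //; exists n.+1.
exists y; split=> // [|z zy]; first by apply: uy.1; exists 0%N.
have [_ [n _ <-] zn] := uy.2 z zy.
exists (u n), (u n.+1); split=> //; last by apply: uy.1; exists n.+1.
by have [] := fP (u n) (ua n).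
Qed.

(** The infinite [t] below [cf a] says that the cofinality is uncountable. The factor [seg a]
    matters when [J] is empty. *)
Lemma club_bigcap t e a I (J : set I) (C : I -> set O) :
  infinite_set (seg t) -> t < cf a -> (J #<= seg e)%card -> e < cf a ->
  (forall j, J j -> club_in a (C j)) ->
  club_in a (seg a `&` \bigcap_(j in J) C j).
Proof.
move=> tinf tcf Je ecf Cclub.
have [t0 t0t] := infinite_setN0 tinf.
have alim := lt_cf_limit t0t tcf.
split; last first.
  move=> b ba blim [_ bunb]; split=> // j Jj; apply: (Cclub j Jj).2 => //.
  split=> [x []//|x /bunb[y [[_ yC] yb] xy]].
  by exists y => //; split=> //; exact: yC.
split=> [x []//|x xa].
(* A [Q]-step passes a point of every [C j], so a supremum of omega many steps is a limit of each
   [C j]. *)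
pose Q y z := forall j, J j -> exists c, [/\ C j c, y <= c & c < z].
have Qnext y : y < a -> exists z, [/\ y < z, z < a & Q y z].
  move=> ya; have /boolp.choice[n nP] : forall j, exists c,
      J j -> [/\ C j c, y <= c & c < a].
    move=> j; have [Jj|nJj] := pselect (J j); last by exists y.
    have [[Ca Cunb] _] := Cclub j Jj; have [c Cc yc] := Cunb y ya.
    by exists c => _; split=> //; exact: Ca.
  have [||z za nz] := @bounded_lt_cf a e (n @` J) _ _ ecf.
  - by move=> _ [j Jj <-]; have [] := nP j Jj.
  - exact: card_le_trans (card_image_le _ _) Je.
  have [w zw wa] : exists2 w, Order.max y z < w & w < a.
    by apply: alim.2; rewrite gt_max ya za.
  move: zw; rewrite gt_max => /andP[yw zw]; exists w; split=> // j Jj.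
  have [Cn yn na] := nP j Jj; exists (n j); split=> //.
  by apply: lt_trans zw; apply: nz; exists j.
have [y [xy ya ylim yP]] := omega_closure tinf tcf Qnext xa.
exists y; last exact: ltW.
split=> // j Jj; apply: (Cclub j Jj).2 => //; split=> [z []//|z /yP].
move=> [z1 [z2 [zz1 Q12 z2y]]]; have [c [Cc z1c cz2]] := Q12 j Jj.
exists c; last exact: le_trans zz1 z1c.
by split=> //; exact: lt_trans cz2 z2y.
Qed.

Lemma club_setI t a A B : infinite_set (seg t) -> t < cf a ->
  club_in a A -> club_in a B -> club_in a (A `&` B).
Proof.
move=> tinf tcf Aclub Bclub.
have -> : A `&` B = seg a `&` \bigcap_(j in [set: bool]) (if j then A else B).
  apply/seteqP; split=> [x [Ax Bx]|x [_ xAB]].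
    by split; [exact: Aclub.1.1|case].
  by split; [exact: (xAB true)|exact: (xAB false)].
apply: (club_bigcap tinf tcf _ tcf) => [|[] //].
exact: card_le_trans (countableP _) ((infiniteP _).1 tinf).
Qed.

Lemma club_setI_seg a b A : b < a -> club_in a A ->
  unbounded_in b (A `&` seg b) -> club_in b (A `&` seg b).
Proof.
move=> ba [_ Acl] Ab; split=> // x xb xlim [_ xunb]; split=> //.
apply: Acl xlim _; first exact: lt_trans ba.
split=> [y []//|y /xunb[z [[Az _] zx] yz]]; by exists z.
Qed.

End Cofinality.

(** * Club guessing at points of cofinality [k] *)

Section ClubGuessing.
Context {d : Order.disp_t} {O : orderType d}.
Hypothesis O_wo : well_order (<=%O : rel O).
Variables t k : O.
Hypotheses (tinf : infinite_set (seg t)) (tk : t < k) (cfk : cf k = k).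
Implicit Types (a b e m s x y z : O) (A B E : set O).

(** The range of a cofinal map [f] need not be closed; the suprema [s n] of its values before [n]
    form a club. *)
Lemma ex_small_club a : cf a = k ->
  exists C, club_in a C /\ (C #<= seg k)%card.
Proof.
move=> cfa; have [[f [fa funb]] _] := cfP a O_wo; rewrite cfa in fa funb.
have [t0 t0t] := infinite_setN0 tinf.
have klim : limit_ordinal k by apply: (lt_cf_limit O_wo t0t); rewrite cfk.
have /boolp.choice[s sP] : forall n, exists s, n < k ->
    s < a /\ unbounded_in s (f @` seg n).
  move=> n; have [nk|nnk] := pselect (n < k); last by exists n.
  have [|||s sa sunb] := @ex_sup_lt_cf _ _ O_wo a n (f @` seg n).
  - by move=> _ [x xn <-]; apply: fa; exists x => //; exact: lt_trans nk.
  - exact: card_image_le.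
  - by rewrite cfa.
  by exists s.
have s_gt x n : x < n -> n < k -> f x < s n.
  by move=> xn nk; apply: (sP n nk).2.1; exists x.
have s_le n n' : n <= n' -> n' < k -> s n <= s n'.
  move=> nn' n'k; rewrite leNgt; apply/negP => lt.
  have [_ [x xn <-]] := (sP n (le_lt_trans nn' n'k)).2.2 _ lt.
  by rewrite leNgt s_gt// (lt_le_trans xn).
have sunb x : x < a -> exists2 n, n < k & x < s n.
  move=> xa; have [_ [n nk <-] xn] := funb x xa.
  have [n' nn' n'k] := klim.2 n nk; exists n' => //.
  by apply: le_lt_trans xn _; exact: s_gt.
exists (s @` seg k); split; last exact: card_image_le.
split; first split=> [_ [n nk <-]|x /sunb[n nk xn]].
- by have [] := sP n nk.
- by exists (s n); [exists n|exact: ltW].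
move=> b ba blim sb; have [n0 n0k bn0] := sunb b ba.
have [n [nk bn] minn] := ex_least O_wo (A := [set n | n < k /\ b <= s n])
  (ex_intro _ n0 (conj n0k (ltW bn0))).
(* If [b < s n], then [b <= f x] for some [x < n], and [s x < b] by minimality of [n]. As [b] is a
   limit of the club, [s x < s y < b] for some [y]; then [x < y], so [f x < s y < b]. *)
exists n => //; apply/eqP; rewrite eq_le bn andbT leNgt; apply/negP => bsn.
have [_ [x xn <-]] := (sP n nk).2.2 b bsn; rewrite leNgt => /negP; apply.
have sxb : s x < b.
  rewrite ltNge; apply/negP => bsx.
  by have := minn x (conj (lt_trans xn nk) bsx); rewrite leNgt xn.
have [_ [[y yk <-] syb] sxy] := limit_unbounded_lt blim sb sxb.
apply: lt_trans syb; apply: s_gt yk; rewrite ltNge; apply/negP => yx.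
by have := s_le _ _ yx (lt_trans xn nk); rewrite leNgt sxy.
Qed.

(** Increasing choices in [E] along [k] stay bounded because [k < cf a]; their supremum has
    cofinality [cf k = k]. *)
Lemma club_limit_of_cof a E : k < cf a -> club_in a E ->
  exists b, [/\ b < a, cf b = k & unbounded_in b (E `&` seg b)].
Proof.
move=> ka [[Ea Eunb] _].
have [f fE] : exists f : O -> O, forall n,
    f n = xget a (E `&` [set y | forall x, x < n -> f x < y]).
  apply: (wf_recursion a (wo_lt_wf O_wo)) => n g h gh; congr xget.
  by apply/seteqP; split=> y [Ey yP]; split=> // x xn; have := yP x xn; rewrite gh.
have fP n : n < k -> E (f n) /\ forall x, x < n -> f x < f n.
  elim/(wo_ind O_wo): n => n IH nk; rewrite [f n]fE.
  suff [y yP] : E `&` [set y | forall x, x < n -> f x < y] !=set0.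
    exact: (xgetPex a (ex_intro _ y yP)).
  have [|||z za zP] := @bounded_lt_cf _ _ O_wo a n (f @` seg n).
  - by move=> _ [x xn <-]; apply: Ea; have [] := IH x xn (lt_trans xn nk).
  - exact: card_image_le.
  - exact: lt_trans nk ka.
  have [y Ey zy] := Eunb z za; exists y; split=> // x xn.
  by apply: lt_le_trans zy; apply: zP; exists x.
have [||b ba bunb] := @ex_sup_lt_cf _ _ O_wo a k (f @` seg k) _ _ ka.
- by move=> _ [x xk <-]; apply: Ea; have [] := fP x xk.
- exact: card_image_le.
exists b; split=> //.
  rewrite -[RHS]cfk; apply: (cf_increasing_map O_wo) bunb => x y xy yk.
  by have [_] := fP y yk; exact.
split=> [x []//|x xb]; have [_ [n nk <-] xn] := bunb.2 x xb.
exists (f n) => //; split; first by have [] := fP n nk.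
by apply: bunb.1; exists n.
Qed.

(* Shelah's club guessing. If it failed, iterate [k_p] times the passage from
   [C] to its trace on a club that it does not guess; the set [C a], of size
   [k], would lose a point at each stage. *)
Lemma club_guessing k_p m : is_cardinal k_p -> k < k_p -> k_p < cf m ->
  exists C : O -> set O, forall E, club_in m E ->
    exists a, [/\ a < m, cf a = k, unbounded_in a (C a) & C a `<=` E].
Proof.
move=> k_p_card k_k_p k_p_m; apply: contrapT => nguess.
have tm : t < cf m := lt_trans tk (lt_trans k_k_p k_p_m).
(* [F C] is a club that [C] fails to guess. *)
have /boolp.choice[F FP] : forall C : O -> set O, exists E, club_in m E /\
    forall a, a < m -> cf a = k -> unbounded_in a (C a) -> ~ (C a `<=` E).
  move=> C; apply: contrapT => nE; apply: nguess; exists C => E Eclub.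
  apply: contrapT => na; apply: nE; exists E; split=> // a am cfa Ca CE.
  by apply: na; exists a.
have /boolp.choice[C CP] : forall a, exists C, cf a = k ->
    club_in a C /\ (C #<= seg k)%card.
  move=> a; have [/ex_small_club[C ?]|ncf] := pselect (cf a = k).
    by exists C.
  by exists set0.
pose trace (G : set O) (a : O) := C a `&` G.
have [E EE] : exists E : O -> set O, forall n,
    E n = seg m `&` \bigcap_(j in seg n) F (trace (E j)).
  apply: (wf_recursion set0 (wo_lt_wf O_wo)) => n g h gh; congr (_ `&` _).
  by apply: eq_bigcapr => j jn; rewrite gh.
have Eclub n : n <= k_p -> club_in m (E n).
  move=> nk; rewrite EE; apply: (club_bigcap O_wo tinf tm _ k_p_m).
    exact: card_seg_le.
  by move=> j _; have [] := FP (trace (E j)).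
have Esub n n' : n <= n' -> E n' `<=` E n.
  move=> nn' x; rewrite !EE => -[xm xF]; split=> // j jn.
  by apply: xF; exact: lt_le_trans nn'.
(* The clubs [E n] decrease, so a limit [a] of the last one is a limit of all. Each trace is then
   unbounded in [a], and some point of it must leave the next club. *)
have [a [am cfa aunb]] :=
  club_limit_of_cof (lt_trans k_k_p k_p_m) (Eclub _ (lexx _)).
have [Cclub Cle] := CP a cfa.
have /boolp.choice[x xP] : forall n, exists x, n < k_p ->
    [/\ C a x, E n x & ~ F (trace (E n)) x].
  move=> n; have [nk|nnk] := pselect (n < k_p); last by exists n.
  have En : club_in a (E n `&` seg a).
    apply: club_setI_seg am (Eclub n (ltW nk)) _; split=> [y []//|y ya].
    have [z [Ez za] yz] := aunb.2 y ya; exists z => //; split=> //.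
    exact: Esub (ltW nk) _ Ez.
  have [traceunb _] : club_in a (trace (E n) a).
    have -> : trace (E n) a = C a `&` (E n `&` seg a).
      rewrite /trace; apply/seteqP; split=> [y [Cy Ey]|y [Cy []]] //.
      by split=> //; split=> //; exact: Cclub.1.1.
    by apply: (club_setI O_wo tinf) => //; rewrite cfa.
  have [_ nF] := FP (trace (E n)).
  have /nonsubset[y [[Cy Ey] nFy]] := nF a am cfa traceunb.
  by exists y.
apply: (k_p_card k k_k_p); apply: card_le_trans Cle.
(* [E n'] is included in [F (trace (E n))], which misses [x n] but contains [x n']. *)
have xlt n n' : n < n' -> n' < k_p -> x n <> x n'.
  move=> nn' n'k xx; have [_ _] := xP n (lt_trans nn' n'k); apply.
  by have [_ + _] := xP n' n'k; rewrite EE xx => -[_]; apply.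
apply: (@inj_card_leW _ _ _ _ x) => [n /xP[]//|n n' nk n'k xx].
have [lt|lt|//] := ltgtP n n'; first by case: (xlt n n').
by case: (xlt n' n).
Qed.

End ClubGuessing.

(** * Covering sequences and preimages of clubs *)

Section GoodPoints.
Context {d : Order.disp_t} {O : orderType d}.
Hypothesis O_wo : well_order (<=%O : rel O).
Variables (t l : O) (D : O -> O -> set O).
Implicit Types (a b c e m s x y z : O) (A B E : set O).

Definition covered_below y A : Prop :=
  exists c i, [/\ c < y, i < t & A `<=` D i c].

Lemma covered_below_sub y z A B :
  y <= z -> A `<=` B -> covered_below y B -> covered_below z A.
Proof.
move=> yz AB [c [i [cy it BD]]]; exists c, i; split=> //.
  exact: lt_le_trans yz.
exact: subset_trans BD.
Qed.

(* At each stage the new demands come from at most [m < cf l] guesses, so they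
   can be met below [l]; at a limit stage all demands have been met before, so
   the supremum of the earlier values is the least admissible value. *)
Lemma ex_covering_sequence m E (C : O -> set O) :
  cf l = l -> m < l -> limit_ordinal m -> club_in l E ->
  exists g : O -> O, [/\ forall x, x < m -> E (g x),
    forall x y, x < y -> y < m -> g x < g y,
    forall x y a, x < y -> y < m -> a < m ->
      covered_below l (g @` (C a `&` seg x)) ->
      covered_below (g y) (g @` (C a `&` seg x)) &
    forall x, x < m -> limit_ordinal x -> unbounded_in (g x) (g @` seg x)].
Proof.
move=> cfl ml mlim [[El Eunb] Ecl].
pose next (g : O -> O) y := [set z | [/\ E z, forall x, x < y -> g x < z &
  forall x a, x < y -> a < m -> covered_below l (g @` (C a `&` seg x)) ->
    covered_below z (g @` (C a `&` seg x))]].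
pose least g y := next g y `&` [set z | forall z', next g y z' -> z <= z'].
have next_ext y g h : (forall x, x < y -> g x = h x) -> next g y = next h y.
  move=> gh; have im x a : x < y -> g @` (C a `&` seg x) = h @` (C a `&` seg x).
    by move=> xy; apply: eq_imagel => z [_ zx]; exact/gh/(lt_trans zx).
  apply/seteqP; split=> z [Ez z1 z2]; split=> //.
  - by move=> x xy; rewrite -gh//; exact: z1.
  - by move=> x b xy; rewrite -im//; exact: z2.
  - by move=> x xy; rewrite gh//; exact: z1.
  - by move=> x b xy; rewrite im//; exact: z2.
have [g gE] : exists g, forall y, g y = xget l (least g y).
  apply: (wf_recursion l (wo_lt_wf O_wo)) => y g h gh.
  by rewrite /least (next_ext _ _ _ gh).
have gP y : y < m -> least g y (g y).
  elim/(wo_ind O_wo): y => y IH ym.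
  have gl x : x < y -> g x < l.
    by move=> xy; have [[/El]] := IH x xy (lt_trans xy ym).
  have yl : y < cf l by rewrite cfl; exact: lt_trans ml.
  rewrite [g y]gE; suff [z zP] : next g y !=set0.
    have [z' z'P minz'] := ex_least O_wo (ex_intro _ z zP).
    exact: (xgetPex l (ex_intro (least g y) z' (conj z'P minz'))).
  have [||z1 z1l z1P] := @bounded_lt_cf _ _ O_wo l y (g @` seg y) _ _ yl.
  - by move=> _ [x xy <-]; exact: gl.
  - exact: card_image_le.
  have /boolp.choice[w wP] : forall x, exists w, w < l /\ forall a, a < m ->
      covered_below l (g @` (C a `&` seg x)) ->
      covered_below w (g @` (C a `&` seg x)).
    move=> x; have /boolp.choice[h hP] : forall a, exists c,
        covered_below l (g @` (C a `&` seg x)) ->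
        c < l /\ exists2 i, i < t & g @` (C a `&` seg x) `<=` D i c.
      move=> a; have [[c [i [cl it cP]]]|nc] :=
        pselect (covered_below l (g @` (C a `&` seg x))).
        by exists c => _; split=> //; exists i.
      by exists a.
    have [|||w wl wP] := @bounded_lt_cf _ _ O_wo l m
        (h @` (seg m `&` [set a | covered_below l (g @` (C a `&` seg x))])).
    - by move=> _ [a [_ /hP[]] hl _ <-].
    - apply: card_le_trans (card_image_le _ _) _.
      by apply: subset_card_le => a [].
    - by rewrite cfl.
    exists w; split=> // a am acov; have [_ [i it hi]] := hP a acov.
    by exists (h a), i; split=> //; apply: wP; exists a.
  have [||z2 z2l z2P] := @bounded_lt_cf _ _ O_wo l y (w @` seg y) _ _ yl.
  - by move=> _ [x xy <-]; have [] := wP x.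
  - exact: card_image_le.
  have [z Ez] : exists2 z, E z & Order.max z1 z2 <= z.
    by apply: Eunb; rewrite gt_max z1l z2l.
  rewrite ge_max => /andP[z1z z2z]; exists z; split=> // [x xy|x a xy am acov].
    by apply: lt_le_trans z1z; apply: z1P; exists x.
  have [_ /(_ a am acov)] := wP x; apply: covered_below_sub => //.
  by apply: le_trans z2z; apply/ltW/z2P; exists x.
have gincr x y : x < y -> y < m -> g x < g y.
  by move=> xy /gP[[_ + _] _]; apply.
have gl x : x < m -> g x < l by move=> /gP[[/El]].
exists g; split=> // [x /gP[[]]//|x y a xy ym am|x xm xlim].
  by have [[_ _ + _]] := gP y ym; apply.
have [|||s sl sunb] := @ex_sup_lt_cf _ _ O_wo l x (g @` seg x).
- by move=> _ [y yx <-]; apply: gl; exact: lt_trans xm.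
- exact: card_image_le.
- by rewrite cfl; exact: lt_trans ml.
suff -> : g x = s by [].
apply/eqP; rewrite eq_le; apply/andP; split; last first.
  rewrite leNgt; apply/negP => /sunb.2[_ [y yx <-]].
  by rewrite leNgt gincr.
have gs y : y < x -> g y < s by move=> yx; apply: sunb.1; exists y.
(* The supremum [s] is itself admissible at stage [x], so the least admissible value does not exceed
   it. *)
apply: (gP x xm).2; split=> // [|y a yx am acov].
  apply: Ecl => //.
    apply: unbounded_limit sunb _ _.
      by have [y yx] := xlim.1; exists (g y); exists y.
    move=> _ [y yx <-]; have [z yz zx] := xlim.2 y yx.
    by exists (g z); [exists z|apply: gincr => //; exact: lt_trans xm].
  split=> [y []//|y /sunb.2[_ [z zx <-] yz]]; exists (g z) => //.
  by split; [have [[]] := gP z (lt_trans zx xm)|exact: gs].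
(* The demand from [y] was met at a stage [z] strictly between [y] and [x], by a column below
   [g z < s]. *)
have [z yz zx] := xlim.2 y yx.
have [[_ _ zcov] _] := gP z (lt_trans zx xm).
by apply: covered_below_sub (zcov y a yz am acov) => //; exact/ltW/gs.
Qed.

(** At a limit [x], [g x] is the supremum of the earlier values, so it belongs to [A] once points of
    [A] interleave with those values. *)
Lemma continuous_preimage_club m b (g : O -> O) A :
  infinite_set (seg t) -> t < cf m ->
  (forall x y, x < y -> y < m -> g x < g y) ->
  (forall x, x < m -> limit_ordinal x -> unbounded_in (g x) (g @` seg x)) ->
  unbounded_in b (g @` seg m) -> club_in b A ->
  club_in m [set x | x < m /\ A (g x)].
Proof.
move=> tinf tm gincr gcont gb [[Ab Aunb] Acl].
have gle x y : x <= y -> y < m -> g x <= g y.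
  by rewrite le_eqVlt => /orP[/eqP->//|xy ym]; exact/ltW/gincr.
have glt x : x < m -> g x < b by move=> xm; apply: gb.1; exists x.
have [t0 t0t] := infinite_setN0 tinf.
have mlim := lt_cf_limit O_wo t0t tm.
(* One criterion serves twice: for closure the points [c] are values of [g], for unboundedness they
   come from omega many [Q]-steps. *)
have closed x : x < m -> limit_ordinal x ->
    (forall z, z < x -> exists z1 z2 c,
      [/\ z <= z1 < m, g z1 <= c <= g z2, z2 < x & A c]) -> A (g x).
  move=> xm xlim xP; apply: Acl => //; first exact: glt.
    apply: unbounded_limit (gcont x xm xlim) _ _.
      by have [y yx] := xlim.1; exists (g y); exists y.
    move=> _ [y yx <-]; have [z yz zx] := xlim.2 y yx.
    by exists (g z); [exists z|apply: gincr => //; exact: lt_trans xm].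
  split=> [y []//|y /(gcont x xm xlim).2[_ [z zx <-] yz]].
  have [z1 [z2 [c [/andP[zz1 z1m] /andP[z1c cz2] z2x Ac]]]] := xP z zx.
  have cx : c < g x by apply: le_lt_trans cz2 _; exact: gincr.
  by exists c => //; apply: le_trans yz (le_trans _ z1c); exact: gle.
split; last first.
  move=> x xm xlim xunb; split=> //; apply: closed => // z /xunb.2[y [[ym Ay] yx] zy].
  by exists y, y, (g y); rewrite zy lexx ym.
split=> [x []//|x xm].
pose Q y z := [/\ y < m, z < m & exists c, [/\ A c, g y <= c & c <= g z]].
have [|y [xy ym ylim yP]] := omega_closure O_wo tinf tm (Q := Q) _ xm.
  move=> y ym; have [c Ac yc] := Aunb (g y) (glt y ym).
  have [_ [z zm <-] cz] := gb.2 c (Ab c Ac).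
  have [w] : exists2 w, Order.max y z < w & w < m.
    by apply: mlim.2; rewrite gt_max ym zm.
  rewrite gt_max => /andP[yw zw] wm; exists w; split=> //; split=> //.
  by exists c; split=> //; apply: le_trans cz _; exact/ltW/gincr.
exists y; last exact: ltW.
split=> //; apply: closed => // z /yP[z1 [z2 [zz1 [z1m z2m [c [Ac z1c cz2]]] z2y]]].
by exists z1, z2, c; rewrite zz1 z1m z1c cz2.
Qed.

End GoodPoints.

(** * A good point of cofinality [kappa] in a given club *)

Theorem theorem6p13 (d : Order.disp_t) (O : orderType d)
    (O_wo : well_order (<=%O : rel O))
    (theta kappa lambda kappa_p kappa_pp : O)
    (theta_reg : regular_cardinal theta)
    (kappa_reg : regular_cardinal kappa)
    (lambda_reg : regular_cardinal lambda)
    (lt_theta_kappa : theta < kappa)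
    (lt_kappa_lambda : kappa < lambda)
    (kappa_pE : is_succ_cardinal kappa kappa_p)
    (kappa_ppE : is_succ_cardinal kappa_p kappa_pp)
    (lt_kappa_pp_lambda : kappa_pp < lambda)
    (D : O -> O -> set O)
    (D_cov : covering_matrix theta lambda D)
    (D_unif : uniform_matrix theta lambda D) :
  stationary_in lambda (good_points theta lambda D `&` cof_set lambda kappa).
Proof.
have [_ tinf _] := theta_reg; have [_ kinf cfk] := kappa_reg.
have [_ _ cfl] := lambda_reg; have [kpcard kkp _] := kappa_pE.
have kpm := succ_cardinal_cf O_wo (infinite_seg_le (ltW kkp) kinf) kappa_ppE.
have km := lt_trans kkp kpm; have tm := lt_trans lt_theta_kappa km.
have [t0 t0t] := infinite_setN0 tinf.
have mlim := lt_cf_limit O_wo t0t tm.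
split=> [b [_ []]//|E Eclub].
have [C CP] := club_guessing O_wo tinf lt_theta_kappa cfk kpcard kkp kpm.
have [g [gE gincr gcov gcont]] :=
  ex_covering_sequence O_wo theta D C cfl lt_kappa_pp_lambda mlim Eclub.
have gl x : x < kappa_pp -> g x < lambda by move=> /gE/Eclub.1.1.
have [|||delta dl dunb] :=
  @ex_sup_lt_cf _ _ O_wo lambda kappa_pp (g @` seg kappa_pp).
- by move=> _ [x xm <-]; exact: gl.
- exact: card_image_le.
- by rewrite cfl.
have dlim : limit_ordinal delta.
  apply: unbounded_limit dunb _ _.
    by have [y ym] := mlim.1; exists (g y); exists y.
  move=> _ [y ym <-]; have [z yz zm] := mlim.2 y ym.
  by exists (g z); [exists z|exact: gincr].
have [i it [A Aclub AD]] := D_unif delta dl dlim.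
have := continuous_preimage_club O_wo tinf tm gincr gcont dunb Aclub.
move=> /CP[a [am cfa Cunb CA]].
have alim : limit_ordinal a by apply: (lt_cf_limit O_wo t0t); rewrite cfa.
have gaunb := gcont a am alim.
have gle x y : x <= y -> y < kappa_pp -> g x <= g y.
  by rewrite le_eqVlt => /orP[/eqP->//|xy ym]; exact/ltW/gincr.
have cfga : cf (g a) = kappa.
  rewrite -cfa; apply: (cf_increasing_map O_wo) gaunb => x y xy ya.
  by apply: gincr xy _; exact: lt_trans am.
exists (g a); split; last exact: gE.
split; last by split; [exact: gl|].
split; [exact: gl|by rewrite cfga|exists (g @` C a)].
  split=> [_ [x /Cunb.1 xa <-]|x /gaunb.2[_ [y ya <-] xy]]; first exact: gincr.
  have [z Cz yz] := Cunb.2 y ya; exists (g z); first by exists z.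
  by apply: le_trans xy (gle _ _ yz _); apply: lt_trans am; exact: Cunb.1.
move=> c /gaunb.2[_ [x xa <-] cx].
(* The column [delta] lies below [lambda] and its entry [D i delta] contains the image, so [gcov]
   supplies a column below [g a]. *)
have [] : covered_below theta D (g a) (g @` (C a `&` seg x)).
  apply: gcov => //; exists delta, i; split=> // _ [y [Cy _] <-].
  by apply: AD; have [] := CA y Cy.
move=> c' [j [c'a jt sub]]; exists c', j; split=> //.
(* From [g y < c <= g x] and monotonicity, [y < x]: the part of the witness below [c] comes from
   [C a] below [x]. *)
apply: subset_trans sub => _ [[y Cy <-] gyc]; exists y => //; split=> //.
rewrite /seg /= ltNge; apply/negP => xy.
have := lt_le_trans gyc cx; rewrite ltNge gle//.
by apply: lt_trans am; exact: Cunb.1.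
Qed.
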